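(* Consider the FAS-aided wireless powered NOMA communication network described in the context. The outage probability $P_{\mathrm{out},u_1}=1-\Pr(\gamma_{\mathrm{sic}}>\hat\gamma_{\mathrm{sic}},\ \gamma_{u_1}>\hat\gamma_{u_1})$ of the strong FAS-equipped user $u_1$ is given by $$P_{\mathrm{out},u_1}=\Phi_{\mathbf R_{u_1}}(q,\dots,q;\vartheta_1),\qquad q=\sqrt2\,\mathrm{erf}^{-1}\!\Big(1-4\sqrt{\tilde\gamma_{\max}}\,\mathcal K_1\big(2\sqrt{\tilde\gamma_{\max}}\big)\Big),$$ where $q$ is repeated $N_{u_1}$ times, $\tilde\gamma_{\max}=\max\{\tilde\gamma_{\mathrm{sic}},\tilde\gamma_{u_1}\}$, and $$\tilde\gamma_{\mathrm{sic}}=\frac{\hat\gamma_{\mathrm{sic}}\,d_t^{\alpha}d_{u_1}^{\alpha}}{\overline\gamma L_p\,(p_{u_2}-\hat\gamma_{\mathrm{sic}}p_{u_1})},\qquad \tilde\gamma_{u_1}=\frac{\hat\gamma_{u_1}\,d_t^{\alpha}d_{u_1}^{\alpha}}{\overline\gamma\,p_{u_1}L_p}.$$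
   Context: Parameters: $\overline\gamma$ is the average SNR (transmit power of the power beacon divided by the noise variance), $L_p$ is the frequency-dependent propagation loss, $\alpha>2$ is the path-loss exponent, $d_t$ and $d_{u_1}$ are the distances from the power beacon to the transmitter and from the transmitter to user $u_1$, and $p_{u_1},p_{u_2}$ are the NOMA power allocation factors of the strong user $u_1$ and the weak user $u_2$, with $p_{u_1}+p_{u_2}=1$. $\hat\gamma_{\mathrm{sic}}$ and $\hat\gamma_{u_1}$ are the thresholds for $\gamma_{\mathrm{sic}}$ and $\gamma_{u_1}$ (defined below). $\mathcal K_1$ is the first-order modified Bessel function of the second kind, and $\mathrm{erf}^{-1}$ is the inverse error function. Fluid antenna system (FAS) of user $i$ (here $i=u_1$): a planar grid of $N_i=N_i^1\times N_i^2$ ports, where $N_i^l$ ports are uniformly distributed along a length $W_i^l\lambda$ ($l=1,2$, $\lambda$ the wavelength). Ports are indexed by $n\in\{1,\dots,N_i\}$ through a fixed bijection $n\mapsto(n^1,n^2)\in\{1,\dots,N_i^1\}\times\{1,\dots,N_i^2\}$. The correlation matrix $\mathbf R_i=(\varrho^i_{n,\tilde n})_{1\le n,\tilde n\le N_i}$ has entries $$\varrho^i_{n,\tilde n}=j_0\!\left(2\pi\sqrt{\Big(\tfrac{n^1-\tilde n^1}{N_i^1-1}W_i^1\Big)^2+\Big(\tfrac{n^2-\tilde n^2}{N_i^2-1}W_i^2\Big)^2}\right),$$ with $j_0$ the zero-order spherical Bessel function of the first kind. $\Phi_{\mathbf R_i}(\cdot;\vartheta)$ denotes the joint CDF of the $N_i$-dimensional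 normal distribution with zero mean vector and correlation matrix $\mathbf R_i$; $\vartheta$ (written $\vartheta_1$ for user $u_1$) is the dependence parameter of the Gaussian copula, which is identified (as an approximation) with the port covariances $\varrho^i_{n,\tilde n}$, so that it carries no information beyond $\mathbf R_i$. Channel model: the equivalent channel gain $g^{n}_{\mathrm{eq},i}$ at port $n$ is the product of the energy-link gain and the information-link gain, which are independent exponential random variables of unit mean (Rayleigh fading). The joint distribution of $(g^1_{\mathrm{eq},i},\dots,g^{N_i}_{\mathrm{eq},i})$ is modelled by the Gaussian copula: with $F_{n}$ the CDF of $g^n_{\mathrm{eq},i}$ and $\phi^{-1}(u)=\sqrt2\,\mathrm{erf}^{-1}(2u-1)$ the standard normal quantile function, $\Pr(g^1_{\mathrm{eq},i}\le r,\dots,g^{N_i}_{\mathrm{eq},i}\le r)=\Phi_{\mathbf R_i}(\phi^{-1}(F_1(r)),\dots,\phi^{-1}(F_{N_i}(r));\vartheta)$. Only the best port is activated, so the channel gain of user $i$ is $g_{\mathrm{fas},i}=\max\{g^1_{\mathrm{eq},i},\dots,g^{N_i}_{\mathrm{eq},i}\}$. The SINR of the successive interference cancellation (SIC) step at the strong user $u_1$ and the SNR of $u_1$ after SIC are $$\gamma_{\mathrm{sic}}=\frac{\overline\gamma p_{u_2}L_pd_t^{-\alpha}d_{u_1}^{-\alpha}g_{\mathrm{fas},u_1}}{\overline\gamma p_{u_1}L_pd_t^{-\alpha}d_{u_1}^{-\alpha}g_{\mathrm{fas},u_1}+1},\qquad \gamma_{u_1}=\overline\gamma p_{u_1}L_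pd_t^{-\alpha}d_{u_1}^{-\alpha}g_{\mathrm{fas},u_1}.$$
   Formalization: The formal theorem adds the condition that the SIC threshold times p_{u1} is less than p_{u2}; otherwise the SIC step always fails, the outage probability is 1, and the stated formula is undefined or gives a value below 1. *)

(* Defs.v *)
From HB Require Import structures.
From mathcomp Require Import all_boot all_order all_algebra.
From mathcomp Require Import all_classical all_reals all_analysis.

Set Implicit Arguments.
Unset Strict Implicit.
Unset Printing Implicit Defensive.
Import Order.TTheory GRing.Theory Num.Theory.
Import numFieldNormedType.Exports.

Local Open Scope classical_set_scope.
Local Open Scope ring_scope.

Section SpecialFunctions.
Context {R : realType}.
Implicit Types x y t u : R.

Definition cosh t : R := (expR t + expR (- t)) / 2.

(* Modified Bessel function of the second kind of order nu, for x > 0,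
   by the integral representation
   K_nu(x) = \int_0^oo exp(- x cosh t) cosh(nu t) dt. *)
Definition besselK (nu x : R) : R :=
  (\int[lebesgue_measure]_(t in `[0%R, +oo[)
     (expR (- x * cosh t) * cosh (nu * t)))%R.

Definition spherical_j0 x : R := if x == 0 then 1 else sin x / x.

(* The oriented integral from 0 to x is written out by the sign of x. *)
Definition erf x : R :=
  2 / Num.sqrt pi *
  (if 0 <= x then (\int[lebesgue_measure]_(t in `[0%R, x]) expR (- t ^+ 2))%R
   else - (\int[lebesgue_measure]_(t in `[x, 0%R]) expR (- t ^+ 2))%R).

(* Meaningful for -1 < y < 1; the default value 0 is returned elsewhere. *)
Definition erfinv y : R := xget 0 [set x | erf x = y].

Definition normal_quantile u : R := Num.sqrt 2 * erfinv (2 * u - 1).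

End SpecialFunctions.

Section MultivariateNormal.
Context {R : realType}.

(* Density of N(0, S), for S symmetric positive definite. *)
Definition mvnormal_pdf n (S : 'M[R]_n) (z : 'rV[R]_n) : R :=
  (Num.sqrt ((2 * pi) ^+ n * \det S))^-1 *
  expR (- (z *m invmx S *m z^T) 0 0 / 2).

(* Integral of f over the orthant {z | z_i <= x_i for all i}, as an iterated
   Lebesgue integral.  It is used for f >= 0 measurable only, where by Tonelli
   it is the integral against n-dimensional Lebesgue measure. *)
Fixpoint orthant_integral n : ('rV[R]_n -> \bar R) -> 'rV[R]_n -> \bar R :=
  match n with
  | 0 => fun f _ => f 0
  | m.+1 => fun f x =>
      (\int[lebesgue_measure]_(t in `]-oo, x ord0 ord0])
         orthant_integral (fun z : 'rV[R]_m => f (row_mx t%:M z : 'rV[R]_(1 + m)))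
           (\row_(i < m) x ord0 (lift ord0 i)))%E
  end.

Definition mvnormal_cdf n (S : 'M[R]_n) (x : 'rV[R]_n) : \bar R :=
  orthant_integral (fun z => (mvnormal_pdf S z)%:E) x.

End MultivariateNormal.

Section FluidAntenna.
Context {R : realType}.

(* Correlation matrix of an N1 x N2 planar grid of ports spanning W1 x W2
   wavelengths; port n sits at the grid position [port n].  Positions are
   counted from 0, which leaves their differences unchanged.  If N1 = 1 the
   first offset is 0 / 0 = 0, as it should be (similarly for N2).
   spherical_j0 (2 * pi * |v|) is the mean over the unit sphere of the plane
   waves of wavelength 1 at displacement v, so that for W1, W2 > 0 and [port]
   injective this matrix is positive definite. *)
Definition fas_corr N N1 N2 (port : 'I_N -> 'I_N1 * 'I_N2) (W1 W2 : R) :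
    'M[R]_N :=
  \matrix_(n, m) spherical_j0 (2 * pi * Num.sqrt (
    (((port n).1%:R - (port m).1%:R) / (N1%:R - 1) * W1) ^+ 2 +
    (((port n).2%:R - (port m).2%:R) / (N2%:R - 1) * W2) ^+ 2)).

Definition fas_gain T N (g : 'I_N.+1 -> T -> R) (w : T) : R :=
  \big[Num.max/g ord0 w]_(n < N.+1) g n w.

End FluidAntenna.

Section RandomVariables.
Context d (T : measurableType d) (R : realType) (P : probability T R).

Definition independent_rv (X Y : {RV P >-> R}) : Prop :=
  forall A B : set R, measurable A -> measurable B ->
    P ((X @^-1` A) `&` (Y @^-1` B)) = (P (X @^-1` A) * P (Y @^-1` B))%E.

Definition unit_exponential (X : {RV P >-> R}) : Prop :=
  forall A : set R, measurable A -> distribution P X A = exponential_prob 1 A.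

(* The port gains g follow the Gaussian copula with correlation matrix S.  Only
   r > 0 is considered: for r <= 0 the gains being a.s. positive, the normal
   quantile of their CDF is -oo and both sides vanish. *)
Definition gaussian_copula N (S : 'M[R]_N) (g : 'I_N -> {RV P >-> R}) : Prop :=
  forall r : R, 0 < r ->
    P [set w | forall n, g n w <= r] =
    mvnormal_cdf S (\row_n normal_quantile (fine (cdf (g n) r))).

End RandomVariables.

Section NOMA.
Context {R : realType}.

(* SNR contributed by the signal with power allocation factor p. *)
Definition branch_snr (gbar Lp alpha dt du p g : R) : R :=
  gbar * p * Lp * dt `^ (- alpha) * du `^ (- alpha) * g.

Definition sinr_sic (gbar Lp alpha dt du p1 p2 g : R) : R :=
  branch_snr gbar Lp alpha dt du p2 g /
  (branch_snr gbar Lp alpha dt du p1 g + 1).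

End NOMA.

(* Main.v *)
Require Import Defs.
From HB Require Import structures.
From mathcomp Require Import all_boot all_order all_algebra.
From mathcomp Require Import all_classical all_reals all_analysis.
From mathcomp Require Import measurable_realfun ring lra.
Import Order.TTheory GRing.Theory Num.Theory.
Import numFieldNormedType.Exports.
Local Open Scope classical_set_scope.
Local Open Scope ring_scope.

(* Since the SNR condition forces a positive gain, the success event is
   {g_fas > max (tgamma_sic, tgamma_u)}, so that the outage probability is the
   copula evaluated at the common marginal distribution function of the ports,
   and the point is that P(XY > s^2) = 2 s K_1(2s) for independent unit
   exponentials X and Y.  Almost surely XY > s^2 implies X > s or Y > s, and
   X, Y > s imply XY > s^2; inclusion-exclusion and symmetry then give
   P(XY > s^2) = 2 A - e^(-2s) with
     A = P(X > s, XY > s^2) = \int_s^oo exp(- x - s^2 / x) dx.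
   Substituting x = s e^t, A = \int_0^oo exp(- 2 s cosh t) s e^t dt.  Splitting
   2 e^t = 2 cosh t + (e^t - e^(-t)), the first part of 2 A is 2 s K_1(2s), and
   the second part has an explicit primitive and equals e^(-2s). *)

(** * The integral A and the Bessel function K_1 *)

(** With [t = ln x - ln s], the Jacobian [x^-1] cancels [s * expR t = x], and [2 * s * cosh t]
    becomes [x + s ^+ 2 / x]. *)
Lemma expR_lnB_cosh {R : realType} {s x : R} : 0 < s -> 0 < x ->
  expR (- (2 * s) * cosh (ln x - ln s)) * (s * expR (ln x - ln s)) * x^-1 =
  expR (- x - s ^+ 2 / x).
Proof.
move=> s0 x0.
have E : expR (ln x - ln s) = x / s by rewrite expRD expRN !lnK.
have EN : expR (- (ln x - ln s)) = s / x by rewrite expRN E invf_div.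
rewrite /cosh E EN (_ : s * (x / s) = x) ?mulfK ?gt_eqF//; last first.
  by rewrite mulrC divfK// gt_eqF.
by congr expR; field; rewrite !gt_eqF.
Qed.

(* The substitution is made by t = ln x - ln s rather than x = s e^t because the
   substitution theorem on [a, +oo[ asks the derivative to converge at +oo. *)
Lemma integral_expR_hyperbola {R : realType} {s : R} : 0 < s ->
  (\int[lebesgue_measure]_(x in `[s, +oo[) (expR (- x - s ^+ 2 / x))%:E =
   \int[lebesgue_measure]_(t in `[0%R, +oo[)
     (expR (- (2 * s) * cosh t) * (s * expR t))%:E)%E.
Proof.
move=> s0.
pose F (x : R) := ln x - ln s.
pose G (t : R) := expR (- (2 * s) * cosh t) * (s * expR t).
have dF (x : R) : 0 < x -> is_derive x 1 F x^-1.
  by move=> x0; rewrite -[x^-1]subr0; apply: is_deriveB; exact: is_derive1_ln.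
have F'E (x : R) : 0 < x -> F^`()%classic x = x^-1.
  by move=> /dF ?; rewrite derive1E derive_val.
have cF (x : R) : 0 < x -> {for x, continuous F}.
  move=> x0; apply: differentiable_continuous.
  by apply/derivable1_diffP; have [] := dF x x0.
have cG : continuous G.
  move=> t; apply: differentiable_continuous; apply/derivable1_diffP.
  by rewrite /G /cosh; exact: ex_derive.
have <- : F s = 0 by rewrite /F subrr.
rewrite -/G (@increasing_ge0_integration_by_substitutiony R F G s).
- apply: eq_integral => x; rewrite inE/= in_itv/= andbT => sx.
  have x0 : 0 < x by exact: lt_le_trans sx.
  by rewrite fctE F'E// expR_lnB_cosh.
- move=> x y; rewrite !in_itv/= !andbT => sx sy xy.
  by rewrite ltrD2r ltr_ln ?posrE//; exact: lt_le_trans s0 _.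
- move=> x; rewrite in_itv/= andbT => sx.
  have x0 : 0 < x by exact: lt_trans sx.
  rewrite /continuous_at F'E//.
  apply: cvg_trans (inv_continuous (lt0r_neq0 x0)).
  apply: near_eq_cvg; near=> y; rewrite F'E//.
  by near: y; exact: lt_nbhsr.
- apply/cvg_ex; exists s^-1.
  apply: cvg_trans (cvg_at_right_filter (inv_continuous (lt0r_neq0 s0))).
  apply: near_eq_cvg; near=> y; rewrite F'E//.
  by apply: lt_trans s0 _; near: y; exact: nbhs_right_gt.
- apply/cvg_ex; exists 0.
  apply: (@cvg_trans _ (x^-1 @[x --> +oo])).
    by apply: near_eq_cvg; near=> y; rewrite F'E//; near: y; exact: nbhs_pinfty_gt.
  by apply/gtr0_cvgV0; [exact: nbhs_pinfty_gt|exact: cvg_id].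
- split.
    move=> x; rewrite in_itv/= andbT => sx.
    by have [] := dF x (lt_trans s0 sx).
  by apply: cvg_at_right_filter; exact: cF.
- apply/cvgryPge => y; near=> x.
  rewrite /F lerBrDr -ler_expR lnK; last first.
    by rewrite posrE; near: x; exact: nbhs_pinfty_gt.
  by near: x; exact: nbhs_pinfty_ge.
- exact: continuous_subspaceT.
- by move=> x _; rewrite /G !mulr_ge0 ?expR_ge0// ltW.
Unshelve. all: end_near. Qed.

(** The integrand is dominated by the unit exponential density [expR (- x)], whose total mass is
    1. *)
Lemma integral_expR_hyperbola_fin_num {R : realType} {s : R} : 0 < s ->
  (\int[lebesgue_measure]_(x in `[s, +oo[)
     (expR (- x - s ^+ 2 / x))%:E)%E \is a fin_num.
Proof.
move=> s0.
have mf : measurable_fun `[s, +oo[%classic (fun x : R => expR (- x - s ^+ 2 / x)).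
  apply: subspace_continuous_measurable_fun => //.
  apply: continuous_in_subspaceT => x; rewrite inE/= in_itv/= andbT => sx.
  have x0 : x != 0 by rewrite gt_eqF// (lt_le_trans s0).
  apply: continuous_comp; last exact: continuous_expR.
  apply: continuousB; first exact: continuousN.
  by apply: continuousM; [exact: cst_continuous|exact: inv_continuous].
have mp : measurable_fun setT (EFin \o @exponential_pdf R 1).
  by apply/measurable_EFinP; exact: measurable_exponential_pdf.
rewrite ge0_fin_numE; last by apply: integral_ge0 => x _; rewrite lee_fin expR_ge0.
apply: (@le_lt_trans _ _ (\int[lebesgue_measure]_x (exponential_pdf 1 x)%:E)%E);
  last by rewrite integral_exponential_pdf ?ltry.
apply: (@le_trans _ _
    (\int[lebesgue_measure]_(x in `[s, +oo[) (exponential_pdf 1 x)%:E)%E);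
  last first.
  apply: ge0_subset_integral => //.
  by move=> x _; rewrite lee_fin exponential_pdf_ge0.
apply: ge0_le_integral => //.
- exact/measurable_EFinP.
- exact: measurable_funTS.
- move=> x; rewrite /= in_itv/= andbT => sx.
  have x0 : 0 < x := lt_le_trans s0 sx.
  rewrite (exponential_pdfE _ (ltW x0)) mul1r mulN1r lee_fin ler_expR.
  by rewrite lerBlDr lerDl divr_ge0 ?sqr_ge0// ltW.
Qed.

Lemma integral_expR_cosh_sinh {R : realType} {s : R} : 0 < s ->
  (\int[lebesgue_measure]_(t in `[0%R, +oo[)
     (expR (- (2 * s) * cosh t) * (s * (expR t - expR (- t))))%:E =
   (expR (- (2 * s)))%:E)%E.
Proof.
move=> s0.
pose F (t : R) : R := - expR (- (2 * s) * cosh t).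
have dF (t : R) : is_derive t 1 F
    (expR (- (2 * s) * cosh t) * (s * (expR t - expR (- t)))).
  rewrite /F /cosh; apply: is_derive_eq.
  rewrite /GRing.scale/=; by field.
have derivable_continuous (f : R -> R) : (forall t, derivable f t 1) -> continuous f.
  by move=> df t; apply: differentiable_continuous; apply/derivable1_diffP.
have cF : continuous F by apply: derivable_continuous => t; have [] := dF t.
(* The first 0 is the lower endpoint, the second the limit of [F] at infinity; the integral is thus
   [- F 0], where [cosh 0 = 1]. *)
rewrite (@ge0_continuous_FTC2y _ _ F 0 0).
- by rewrite /F /cosh oppr0 expR0 (_ : 1 + 1 = 2)// divff// mulr1 EFinN oppeK add0e.
- move=> t t0; rewrite !mulr_ge0 ?expR_ge0 ?(ltW s0)//.
  by rewrite subr_ge0 ler_expR; lra.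
- apply: continuous_subspaceT; apply: derivable_continuous => t.
  by rewrite /cosh; exact: ex_derive.
- rewrite /F -oppr0; apply: cvgN.
  (* The minorant [s * t] comes from [1 + t <= expR t]. *)
  have cosh_y : 2 * s * cosh t @[t --> +oo] --> +oo.
    apply/cvgryPge => y; near=> t.
    apply: (@le_trans _ _ (s * t)).
      by rewrite mulrC -ler_pdivrMr//; near: t; exact: nbhs_pinfty_ge.
    have -> : 2 * s * cosh t = s * (expR t + expR (- t)) by rewrite /cosh; field.
    rewrite ler_pM2l//.
    have := expR_ge1Dx t; have := expR_gt0 (- t); lra.
  under eq_fun do rewrite mulNr.
  exact: (cvg_comp _ _ cosh_y (@cvgr_expR R)).
- by move=> t _; have [] := dF t.
- exact/cvg_at_right_filter/cF.
- by move=> t _; rewrite derive1E derive_val.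
Unshelve. all: end_near. Qed.

Lemma besselK1_hyperbola {R : realType} {s : R} : 0 < s ->
  (2%:E * \int[lebesgue_measure]_(x in `[s, +oo[) (expR (- x - s ^+ 2 / x))%:E =
   (2 * s * besselK 1 (2 * s) + expR (- (2 * s)))%:E)%E.
Proof.
move=> s0; have := integral_expR_hyperbola_fin_num s0.
rewrite integral_expR_hyperbola// => finA.
have cosh_ge0 (t : R) : 0 <= cosh t by rewrite divr_ge0// addr_ge0// expR_ge0.
have mcosh : measurable_fun setT (@cosh R).
  apply: measurable_funM => //; apply: measurable_funD => //.
  exact: measurableT_comp.
have mcosh1 : measurable_fun setT (fun t : R => cosh (1 * t)).
  exact: measurableT_comp.
have mE : measurable_fun setT (fun t : R => expR (- (2 * s) * cosh t)).
  by apply: measurableT_comp => //; exact: measurable_funM.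
pose B := (\int[lebesgue_measure]_(t in `[0%R, +oo[)
  (expR (- (2 * s) * cosh t) * cosh (1 * t))%:E)%E.
have split_exp :
    (2%:E * \int[lebesgue_measure]_(t in `[0%R, +oo[)
      (expR (- (2 * s) * cosh t) * (s * expR t))%:E =
     (2 * s)%:E * B + (expR (- (2 * s)))%:E)%E.
  have mexpR (c : R) : measurable_fun setT (fun t : R => expR (c * t)).
    exact: measurableT_comp.
  rewrite -integral_expR_cosh_sinh// /B -!ge0_integralZl_EFin//.
  - rewrite -ge0_integralD//.
    + apply: eq_integral => t _; rewrite -!EFinM -EFinD /cosh mul1r.
      by congr EFin; field.
    + by move=> t _; rewrite lee_fin !mulr_ge0 ?cosh_ge0 ?expR_ge0// ltW.
    + by apply: measurable_funTS; apply/measurable_EFinP/measurable_funM => //;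
        exact: measurable_funM.
    + move=> t; rewrite /= in_itv/= andbT => t0.
      rewrite lee_fin !mulr_ge0 ?expR_ge0 ?(ltW s0)//.
      by rewrite subr_ge0 ler_expR; lra.
    + apply: measurable_funTS; apply/measurable_EFinP/measurable_funM => //.
      apply: measurable_funM => //; apply: measurable_funB => //.
      exact: measurableT_comp.
  - by move=> t _; rewrite lee_fin mulr_ge0 ?cosh_ge0 ?expR_ge0.
  - by apply: measurable_funTS; apply/measurable_EFinP/measurable_funM => //.
  - by rewrite mulr_ge0// ltW.
  - by move=> t _; rewrite lee_fin !mulr_ge0 ?expR_ge0// ltW.
  - apply: measurable_funTS; apply/measurable_EFinP/measurable_funM => //.
    exact: measurable_funM.
(* [besselK] is a real-valued integral, namely [fine B], so [B] must be finite to be recovered from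
   it. If [B] were infinite, [split_exp] would make twice the finite integral A infinite. *)
have finB : B \is a fin_num.
  have B0 : (0 <= B)%E.
    by apply: integral_ge0 => t _; rewrite lee_fin mulr_ge0 ?cosh_ge0 ?expR_ge0.
  rewrite ge0_fin_numE// ltey; apply/eqP => By.
  have := fin_numM (isT : 2%:E \is a fin_num) finA.
  by rewrite split_exp By gt0_muley ?lte_fin ?mulr_gt0.
by rewrite split_exp EFinD [in RHS]EFinM /besselK /Rintegral -/B fineK.
Qed.

(** * Densities, joint laws and exponential tails *)

(** The density [p] agrees almost everywhere on [D] with the Radon-Nikodym derivative of [nu], since
    both have the same integral over every measurable subset of [D]. *)
Lemma integral_density {R : realType}
    (nu : {finite_measure set (measurableTypeR R) -> \bar R}) (p : R -> R)
    (D : set R) (f : R -> \bar R) :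
  (forall x, 0 <= p x) -> measurable_fun setT p ->
  (forall A, measurable A ->
    nu A = (\int[lebesgue_measure]_(x in A) (p x)%:E)%E) ->
  measurable D -> nu.-integrable D f ->
  (\int[nu]_(x in D) f x = \int[lebesgue_measure]_(x in D) (f x * (p x)%:E))%E.
Proof.
move=> p0 mp nuE mD intf.
have nu_dom : nu `<< @lebesgue_measure R.
  apply/null_content_dominatesP => A mA A0.
  by rewrite nuE// null_set_integral//; exact/measurable_EFinP/measurable_funTS.
have mf := measurable_int _ intf.
rewrite -(Radon_Nikodym_change_of_variables nu_dom)//.
apply: ae_eq_integral => //.
- apply: emeasurable_funM => //; apply: (measurable_int lebesgue_measure).
  apply: (integrableS _ _ (@subsetT _ _)) => //=.
  exact: Radon_Nikodym_integrable.
- by apply: emeasurable_funM => //; exact/measurable_EFinP/measurable_funTS.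
- apply: ae_eqe_mul2l => /=.
  rewrite Radon_NikodymE//=.
  case: cid => /= h [h1 h2 h3].
  apply: integral_ae_eq => //=.
  + exact: integrableS h2.
  + exact/measurable_EFinP/measurable_funTS.
  + by move=> E ED mE; exact: etrans (esym (h3 _ mE)) (nuE _ mE).
Qed.

(** The joint law of [X] and [Y] agrees with the product of their laws on measurable rectangles, and
    a product measure is determined by these. *)
Lemma independent_rv_prod {d d1 d2 : measure_display} {T : measurableType d}
    {T1 : measurableType d1} {T2 : measurableType d2} {R : realType}
    {P : probability T R} {X : {mfun T >-> T1}} {Y : {mfun T >-> T2}}
    {E : set (T1 * T2)} :
  (forall A B, measurable A -> measurable B ->
     P ((X @^-1` A) `&` (Y @^-1` B)) = (P (X @^-1` A) * P (Y @^-1` B))%E) ->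
  measurable E ->
  P [set w | E (X w, Y w)] = (distribution P X \x distribution P Y)%E E.
Proof.
move=> XY mE.
have mXY : measurable_fun setT (fun w => (X w, Y w)) by exact: measurable_fun_pair.
pose XYm : {mfun T >-> (T1 * T2)%type} := mfun_Sub (mem_set mXY).
by rewrite (product_measure_unique (m' := distribution P XYm)).
Qed.

Lemma exponential_prob_gt {R : realType} {a : R} : 0 <= a ->
  exponential_prob 1 `]a, +oo[ = (expR (- a))%:E.
Proof.
move=> a0; rewrite /exponential_prob.
rewrite integral_itv_obnd_cbnd; last first.
  apply/measurable_EFinP; apply: measurable_funTS.
  exact: measurable_exponential_pdf.
rewrite (@ge0_continuous_FTC2y _ _ (fun x => - expR (- x)) a 0).
- by rewrite EFinN oppeK add0e.
- by move=> x _; rewrite exponential_pdf_ge0.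
(* The density jumps at 0, so its continuity is taken within the half-line from 0 and restricted to
   the one from [a]. *)
- apply: (@continuous_subspaceW R^o _ _ [set` `[0, +oo[%R]).
    by move=> x /=; rewrite !in_itv/= !andbT; exact: le_trans.
  exact: within_continuous_exponential_pdf.
- by rewrite -oppr0; apply: cvgN; exact: cvgr_expR.
- by move=> x _.
- apply/cvg_at_right_filter; apply: cvgN; apply: continuous_comp.
    exact: continuousN.
  exact: continuous_expR.
- move=> x; rewrite in_itv/= andbT => ax.
  rewrite exponential_pdfE; last by rewrite (le_trans a0)// ltW.
  rewrite derive1E derive_val mul1r mulN1r /GRing.scale/=.
  by rewrite mulrN1 opprK.
Qed.

Lemma measurable_ltr_set {d : measure_display}
    {T : measurableType d} {R : realType} {f g : T -> R} :
  measurable_fun setT f -> measurable_fun setT g ->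
  measurable [set x | f x < g x].
Proof.
move=> mf mg; rewrite (_ : [set x | f x < g x] =
  setT `&` (fun x => f x < g x) @^-1` [set true]); last by rewrite setTI.
exact: measurable_fun_ltr.
Qed.

(** * The law of a product of two independent unit exponentials *)

(** Given [X = x] with [s < x], the event says that [Y] exceeds [s ^+ 2 / x], which has probability
    [expR (- (s ^+ 2 / x))]; this is then integrated against the density of [X]. *)
Lemma prob_exp_gt_prod_gt {d : measure_display}
    {T : measurableType d} {R : realType} {P : probability T R}
    {X Y : {RV P >-> R}} {s : R} : 0 < s ->
  unit_exponential X -> unit_exponential Y -> independent_rv X Y ->
  P [set w | s < X w /\ s ^+ 2 < X w * Y w] =
  (\int[lebesgue_measure]_(x in `[s, +oo[) (expR (- x - s ^+ 2 / x))%:E)%E.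
Proof.
move=> s0 Xexp Yexp XY.
have mX : measurable_fun setT (X : T -> measurableTypeR R).
  exact: (measurable_funP X).
have mY : measurable_fun setT (Y : T -> measurableTypeR R).
  exact: (measurable_funP Y).
(* The laws are moved to [measurableTypeR R], the type carrying
   [lebesgue_measure], which is a different structure from that of [R]. *)
pose X' : {mfun T >-> measurableTypeR R} :=
  @mfun_Sub _ _ T (measurableTypeR R) X (mem_set mX).
pose Y' : {mfun T >-> measurableTypeR R} :=
  @mfun_Sub _ _ T (measurableTypeR R) Y (mem_set mY).
have Y'exp A : measurable A -> distribution P Y' A = exponential_prob 1 A.
  exact: Yexp.
pose E := [set z : measurableTypeR R * measurableTypeR R | s < z.1 /\ s ^+ 2 < z.1 * z.2].
have mE : measurable E.
  apply: measurableI.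
    exact: measurable_ltr_set.
  by apply: measurable_ltr_set => //; exact: measurable_funM.
rewrite (@independent_rv_prod _ _ _ _ _ _ _ P X' Y' _ XY mE) /product_measure1.
transitivity (\int[distribution P X']_(x in `]s, +oo[)
    (expR (- (s ^+ 2 / x)))%:E)%E.
  (* The section of [E] at [x] is the half-line above [s ^+ 2 / x] if [s < x], and is empty
     otherwise. *)
  rewrite [RHS]integral_mkcond; apply: eq_integral => x _ /=.
  rewrite patchE; case: ifPn => [|].
    rewrite inE/= in_itv/= andbT => sx.
    have x0 : 0 < x := lt_trans s0 sx.
    rewrite (_ : xsection E x = `]s ^+ 2 / x, +oo[%classic).
      rewrite Y'exp// exponential_prob_gt// divr_ge0 ?sqr_ge0//; exact: ltW.
    apply/seteqP; split => y; rewrite /xsection/= in_itv/= andbT inE /E/=.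
      by case=> _; rewrite ltr_pdivrMr// mulrC.
    rewrite ltr_pdivrMr// mulrC => ry.
    by split.
  rewrite notin_setE/= in_itv/= andbT => sx.
  rewrite (_ : xsection E x = set0) ?measure0//.
  by apply/seteqP; split => y //; rewrite /xsection/= inE/= => -[].
have mf : measurable_fun `]s, +oo[%classic (fun x : R => expR (- (s ^+ 2 / x))).
  apply: subspace_continuous_measurable_fun => //.
  apply: continuous_in_subspaceT => x; rewrite inE/= in_itv/= andbT => sx.
  have x0 : x != 0 by rewrite gt_eqF// (lt_trans s0).
  apply: continuous_comp; last exact: continuous_expR.
  apply: continuousN.
  by apply: continuousM; [exact: cst_continuous|exact: inv_continuous].
have mp := @measurable_exponential_pdf R 1.
rewrite (@integral_density R
  (distribution P X') (exponential_pdf 1))//.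
- rewrite integral_itv_obnd_cbnd.
    apply: eq_integral => x; rewrite inE/= in_itv/= andbT => sx.
    rewrite exponential_pdfE; last by rewrite (le_trans (ltW s0)).
    by rewrite -EFinM mul1r mulN1r -expRD addrC.
  apply: emeasurable_funM; apply/measurable_EFinP => //.
  exact: measurable_funTS.
- by move=> x; rewrite exponential_pdf_ge0.
(* A function with values between 0 and 1 is integrable against a probability law. *)
- apply: measurable_bounded_integrable => //.
    by rewrite (le_lt_trans (probability_le1 _ _))// ltry.
  exists 1; split; first exact: num_real.
  move=> M M1 x; rewrite /= in_itv/= andbT => sx.
  rewrite ger0_norm ?expR_ge0// (le_trans _ (ltW M1))// -expR0 ler_expR.
  by rewrite oppr_le0 divr_ge0 ?sqr_ge0// (le_trans (ltW s0))// ltW.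
Qed.

Lemma independent_rvC {d : measure_display} {T : measurableType d}
    {R : realType} {P : probability T R} {X Y : {RV P >-> R}} :
  independent_rv X Y -> independent_rv Y X.
Proof. by move=> XY A B mA mB; rewrite setIC muleC XY. Qed.

Lemma exponential_prob_lt0 {R : realType} : exponential_prob (1 : R) `]-oo, 0[ = 0%E.
Proof.
apply: integral0_eq => x /=; rewrite in_itv/= => x0.
by rewrite lt0_exponential_pdf.
Qed.

Lemma prob_exp_prod_gt {d : measure_display}
    {T : measurableType d} {R : realType} {P : probability T R}
    {X Y : {RV P >-> R}} {s : R} : 0 < s ->
  unit_exponential X -> unit_exponential Y -> independent_rv X Y ->
  P [set w | s ^+ 2 < X w * Y w] = (2 * s * besselK 1 (2 * s))%:E.
Proof.
move=> s0 Xexp Yexp XY.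
pose U := [set w | s < X w /\ s ^+ 2 < X w * Y w].
pose V := [set w | s < Y w /\ s ^+ 2 < X w * Y w].
(* Two negative factors can also have a product above [s ^+ 2]; that case is confined to the null
   event [N]. *)
pose N := [set w | X w < 0 /\ s ^+ 2 < X w * Y w].
have mXY : measurable [set w | s ^+ 2 < X w * Y w].
  by apply: measurable_ltr_set => //; exact: measurable_funM.
have mU : measurable U by apply: measurableI => //; exact: measurable_ltr_set.
have mV : measurable V by apply: measurableI => //; exact: measurable_ltr_set.
have mX0 : measurable [set w | X w < 0] by exact: measurable_ltr_set.
have mN : measurable N by exact: measurableI.
have N0 : P N = 0%E.
  apply: (subset_measure0 (B := [set w | X w < 0])) => //; first by move=> w [].
  have -> : [set w | X w < 0] = X @^-1` `]-oo, 0[.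
    by apply/seteqP; split => w; rewrite /= in_itv.
  by rewrite -(@exponential_prob_lt0 R); exact: Xexp.
have -> : [set w | s ^+ 2 < X w * Y w] = (U `|` V) `|` N.
  apply/seteqP; split => w /=; last by case=> [[[]|[]]|[]].
  move=> sXY; case: (ltP (X w) 0) => [X0|X0]; first by right.
  left; case: (ltP s (X w)) => [sX|Xs]; first by left.
  (* With [0 <= X w], two factors at most [s] would give [X w * Y w <= X w * s <= s * s]. *)
  right; split => //; rewrite ltNge; apply/negP => Ys; move: sXY.
  rewrite ltNge => /negP; apply; rewrite expr2.
  by rewrite (le_trans (ler_wpM2l X0 Ys))// ler_wpM2r// ltW.
have PU := prob_exp_gt_prod_gt s0 Xexp Yexp XY.
have PV : P V = P U.
  rewrite PU -(prob_exp_gt_prod_gt s0 Yexp Xexp (independent_rvC XY)).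
  by congr (P _); apply/seteqP; split => w /=; rewrite [Y w * _]mulrC.
have PUV : P (U `&` V) = (expR (- (2 * s)))%:E.
  have -> : U `&` V = (X @^-1` `]s, +oo[) `&` (Y @^-1` `]s, +oo[).
    apply/seteqP; split => w /=; rewrite !in_itv/= !andbT.
      by case=> -[sX _] [sY _].
    case=> sX sY; suff sXY : s ^+ 2 < X w * Y w by [].
    by rewrite expr2 ltr_pM// ltW.
  rewrite XY// -[P (X @^-1` _)]/(distribution P X _).
  rewrite -[P (Y @^-1` _)]/(distribution P Y _) Xexp// Yexp// exponential_prob_gt ?ltW//.
  by rewrite -EFinM -expRD mulr_natl mulr2n opprD.
transitivity (P U + P V - P (U `&` V))%E.
  rewrite measureU0//; last exact: measurableU.
  by rewrite measureUfinl// (le_lt_trans (probability_le1 _ _))// ltry.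
rewrite PV PUV PU -mule2n -mule_natl besselK1_hyperbola//.
by rewrite -EFinB addrK.
Qed.

(** Complement of the event of [prob_exp_prod_gt] at [s = Num.sqrt r]; it supplies the marginal law
    of every port. *)
Lemma cdf_exp_prod {d : measure_display}
    {T : measurableType d} {R : realType} {P : probability T R}
    {X Y Z : {RV P >-> R}} {r : R} : 0 < r ->
  unit_exponential X -> unit_exponential Y -> independent_rv X Y ->
  (forall w, Z w = X w * Y w) ->
  cdf Z r = (1 - 2 * Num.sqrt r * besselK 1 (2 * Num.sqrt r))%:E.
Proof.
move=> r0 Xexp Yexp XY ZE.
rewrite EFinB -(prob_exp_prod_gt _ Xexp Yexp XY) ?sqrtr_gt0//.
rewrite sqr_sqrtr ?ltW// -probability_setC /cdf /distribution /pushforward.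
  congr (P _); apply/seteqP; split => w /=; rewrite in_itv/= ZE.
    by rewrite leNgt => /negP.
  by move=> /negP; rewrite -leNgt.
by apply: measurable_ltr_set => //; exact: measurable_funM.
Qed.

(** * From the SINR conditions to the outage probability *)

Lemma fas_gain_le {R : realType} {T : Type} {N : nat} {g : 'I_N.+1 -> T -> R}
    {w : T} {r : R} :
  reflect (forall n, g n w <= r) (fas_gain g w <= r).
Proof.
apply: (iffP idP) => [gr n|gr]; last by rewrite /fas_gain; apply/bigmax_leP; split.
by apply: le_trans gr; exact: le_bigmax.
Qed.

(** Cleared of denominators, both conditions are linear in [x]; [hsic * p1 < p2] makes the
    coefficient of [x] in the SIC condition positive, so that it is a lower bound on [x]. *)
Lemma noma_success {R : realType} {gbar Lp alpha dt du p1 p2 hsic hu x : R} :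
  0 < gbar -> 0 < Lp -> 0 < dt -> 0 < du -> 0 < p1 -> 0 < hu ->
  hsic * p1 < p2 ->
  (hsic < sinr_sic gbar Lp alpha dt du p1 p2 x) &&
  (hu < branch_snr gbar Lp alpha dt du p1 x) =
  (Num.max (hsic * dt `^ alpha * du `^ alpha / (gbar * Lp * (p2 - hsic * p1)))
    (hu * dt `^ alpha * du `^ alpha / (gbar * p1 * Lp)) < x).
Proof.
move=> gbar0 Lp0 dt0 du0 p10 hu0 feas.
rewrite gt_max /sinr_sic /branch_snr !powRN.
have := powR_gt0 alpha dt0; have := powR_gt0 alpha du0.
move: (dt `^ alpha) (du `^ alpha) => D U U0 D0.
(* [k] is the factor common to both branches: the signal of power factor [p] has SNR [k * p * x]. *)
pose k := gbar * Lp / (D * U).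
have k0 : 0 < k by rewrite divr_gt0 ?mulr_gt0.
have dp0 : 0 < p2 - hsic * p1 by rewrite subr_gt0.
have branchE p : gbar * p * Lp * D^-1 * U^-1 * x = k * p * x.
  by rewrite /k; field; rewrite !gt_eqF.
have -> : hu * D * U / (gbar * p1 * Lp) = hu / (k * p1).
  by rewrite /k; field; rewrite !gt_eqF.
have -> : hsic * D * U / (gbar * Lp * (p2 - hsic * p1)) =
    hsic / (k * (p2 - hsic * p1)).
  by rewrite /k; field; rewrite !gt_eqF.
rewrite !branchE !ltr_pdivrMr ?(mulr_gt0 k0)// (_ : x * (k * p1) = k * p1 * x);
  last by rewrite mulrC.
(* The SNR condition is decided first: when it fails both sides are false, and when it holds the
   SINR denominator [k * p1 * x + 1] is positive and can be cleared. *)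
have [hx|_] := ltP hu; last by rewrite !andbF.
rewrite !andbT ltr_pdivlMr; last by rewrite addr_gt0// (lt_trans hu0).
by rewrite -subr_gt0 -[RHS]subr_gt0; congr (0 < _); ring.
Qed.

Theorem theorem1 (R : realType) (d : measure_display) (T : measurableType d)
  (P : probability T R)
  (* system parameters *)
  (gbar Lp alpha dt du p1 p2 : R)
  (gbar_gt0 : 0 < gbar) (Lp_gt0 : 0 < Lp) (alpha_gt2 : 2 < alpha)
  (dt_gt0 : 0 < dt) (du_gt0 : 0 < du)
  (p1_gt0 : 0 < p1) (p2_gt0 : 0 < p2) (p12 : p1 + p2 = 1)
  (* SINR / SNR thresholds *)
  (hsic hu : R) (hsic_gt0 : 0 < hsic) (hu_gt0 : 0 < hu)
  (feasible : hsic * p1 < p2)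
  (* fluid antenna of the strong user, with N.+1 = N1 * N2 ports *)
  (N N1 N2 : nat) (port : 'I_N.+1 -> 'I_N1 * 'I_N2) (port_bij : bijective port)
  (W1 W2 : R) (W1_gt0 : 0 < W1) (W2_gt0 : 0 < W2)
  (* energy-link, information-link and equivalent gains at each port *)
  (ge gi g : 'I_N.+1 -> {RV P >-> R})
  (ge_exp : forall n, unit_exponential (ge n))
  (gi_exp : forall n, unit_exponential (gi n))
  (ge_gi_indep : forall n, independent_rv (ge n) (gi n))
  (g_eq : forall n w, g n w = ge n w * gi n w)
  (g_copula : gaussian_copula (fas_corr port W1 W2) g) :
  let g_fas := fas_gain g in
  let gamma_sic w := sinr_sic gbar Lp alpha dt du p1 p2 (g_fas w) in
  let gamma_u w := branch_snr gbar Lp alpha dt du p1 (g_fas w) in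
  let tgamma_sic := hsic * dt `^ alpha * du `^ alpha /
                    (gbar * Lp * (p2 - hsic * p1)) in
  let tgamma_u := hu * dt `^ alpha * du `^ alpha / (gbar * p1 * Lp) in
  let tgamma_max := Num.max tgamma_sic tgamma_u in
  let q := Num.sqrt 2 * erfinv
    (1 - 4 * Num.sqrt tgamma_max * besselK 1 (2 * Num.sqrt tgamma_max)) in
  (1 - P [set w | (hsic < gamma_sic w)%R /\ (hu < gamma_u w)%R])%E =
  mvnormal_cdf (fas_corr port W1 W2) (const_mx q).
Proof.
move=> g_fas gamma_sic gamma_u tgamma_sic tgamma_u tgamma_max q.
(* Both the copula hypothesis and [cdf_exp_prod] are used at [r = tgamma_max] and ask for [0 < r];
   positivity comes from [tgamma_u]. *)
have tmax_gt0 : 0 < tgamma_max.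
  by rewrite lt_max; apply/orP; right; rewrite divr_gt0 ?mulr_gt0 ?powR_gt0.
have gP w : reflect (forall n, g n w <= tgamma_max) (g_fas w <= tgamma_max).
  exact: fas_gain_le.
have success : [set w | hsic < gamma_sic w /\ hu < gamma_u w] =
    ~` [set w | forall n, g n w <= tgamma_max].
  apply/seteqP; split => w /= => [/andP|gw].
    by rewrite noma_success// => gt /gP; rewrite leNgt gt.
  apply/andP; rewrite noma_success// ltNge; apply/negP => /gP.
  exact: gw.
have m_outage : measurable [set w | forall n, g n w <= tgamma_max].
  rewrite (_ : [set w | _] =
    \bigcap_(n in [set: 'I_N.+1]) (g n @^-1` `]-oo, tgamma_max])).
    by apply: fin_bigcap_measurable => // n _; exact: measurable_sfunP.
  apply/seteqP; split => w /= gw n => [_|]; first by rewrite /= in_itv/=.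
  by have := gw n I; rewrite /= in_itv.
rewrite success -probability_setC ?setCK; last exact: measurableC.
rewrite g_copula//; congr mvnormal_cdf; apply/rowP => n; rewrite !mxE.
rewrite (cdf_exp_prod tmax_gt0 (ge_exp n) (gi_exp n) (ge_gi_indep n) (g_eq n))/=.
(* For [u = 1 - 2 * Num.sqrt r * besselK 1 (2 * Num.sqrt r)], the argument [2 * u - 1] of [erfinv]
   is the one in [q], the same for every port. *)
by rewrite /normal_quantile /q; congr (_ * erfinv _); ring.
Qed.
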